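(* There exists an absolute constant $A>0$ such that for every $D>0$, every $(2,D)$-smooth separable Banach space $(\mathcal X,\|\cdot\|)$, every $f\in\mathcal M(\mathcal X)$ whose increments $d_j$ are $F_{j-1}$-conditionally symmetrically distributed ($j=1,2,\ldots$), and every $p\ge1$, $$\|f^*\|_p\le A\sqrt p\,D\,\|S_2\|_p.$$
   Context: A real Banach space $(\mathcal X,\|\cdot\|)$ is called $(2,D)$-smooth if $\|x+y\|^2+\|x-y\|^2\le 2\|x\|^2+2D^2\|y\|^2$ for all $x,y\in\mathcal X$. For a separable Banach space $\mathcal X$, $\mathcal M(\mathcal X)$ is the class of all martingales $f=(f_0,f_1,\ldots)$ of Bochner-integrable random vectors in $\mathcal X$ with $f_0\equiv 0$, defined on some probability space with respect to some filtration $(F_0,F_1,\ldots)$ (both may depend on $f$). Put $d_j=f_j-f_{j-1}$ for $j\ge1$, $f^*=\sup_{j\ge0}\|f_j\|$, $S_2=\left(\sum_{j=1}^\infty\|d_j\|^2\right)^{1/2}$. For a real random variable $Y$, $\|Y\|_p=(\mathbf E|Y|^p)^{1/p}\in[0,\infty]$. ''$d_j$ is $F_{j-1}$-conditionally symmetrically distributed'' means that the conditional distributions of $d_j$ and $-d_j$ given $F_{j-1}$ coincide almost surely. *)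

(* Defs.v *)
From HB Require Import structures.
From mathcomp Require Import all_boot all_order all_algebra.
From mathcomp Require Import all_classical all_reals all_analysis.

Set Implicit Arguments.
Unset Strict Implicit.
Unset Printing Implicit Defensive.

Import Order.TTheory GRing.Theory Num.Theory.
Import numFieldNormedType.Exports.

Local Open Scope classical_set_scope.
Local Open Scope ring_scope.

Notation borel X := (g_sigma_algebraType (@open X)).

Definition separable (X : topologicalType) : Prop :=
  exists2 S : set X, countable S & dense S.

Definition smooth2 (R : realType) (X : normedModType R) (D : R) : Prop :=
  forall x y : X,
    `|x + y| ^+ 2 + `|x - y| ^+ 2 <= 2 * `|x| ^+ 2 + 2 * D ^+ 2 * `|y| ^+ 2.

Section Bochner.
Context {R : realType} {d : measure_display} {T : measurableType d}.
Context {X : completeNormedModType R}.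
Variable P : probability T R.

Definition simple_vector (s : T -> X) : Prop :=
  finite_set (range s) /\ measurable_fun [set: T] (s : T -> borel X).

Definition simple_vector_integral (A : set T) (s : T -> X) : X :=
  \sum_(x \in range s) fine (P (A `&` s @^-1` [set x])) *: x.

Definition bochner_approx (Y : T -> X) (s : nat -> T -> X) : Prop :=
  (forall n, simple_vector (s n)) /\
  (\int[P]_w (`|Y w - s n w|)%:E)%E @[n --> \oo] --> 0%E.

(* Borel measurability is the same as strong measurability when X is
   separable, which is the only case of interest here. *)
Definition bochner_integrable (Y : T -> X) : Prop :=
  measurable_fun [set: T] (Y : T -> borel X) /\
  exists s, bochner_approx Y s.

(* Meaningful only if Y is Bochner integrable: the limit then exists and does
   not depend on the approximating sequence. *)
Definition bochner_integral (A : set T) (Y : T -> X) : X :=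
  get [set v | exists2 s, bochner_approx Y s &
    simple_vector_integral A (s n) @[n --> \oo] --> v].

(* Z is a version of E(Y | G). *)
Definition is_cond_expectation (G : set (set T)) (Y Z : T -> X) : Prop :=
  [/\ measurable_fun [set: g_sigma_algebraType G]
        (Z : g_sigma_algebraType G -> borel X),
      bochner_integrable Z &
      forall A, G A -> bochner_integral A Z = bochner_integral A Y].

(* k is a regular conditional distribution of Y given G; being a kernel from
   g_sigma_algebraType G, it is G-measurable in its first argument. *)
Definition is_cond_distribution (G : set (set T)) (Y : T -> X)
    (k : R.-pker (g_sigma_algebraType G) ~> borel X) : Prop :=
  forall (A : set T) (B : set (borel X)), G A -> measurable B ->
    (\int[P]_(w in A) k w B)%E = P (A `&` Y @^-1` B).

(* Regular conditional distributions exist and are almost surely unique when X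
   is separable, so it is immaterial which versions are compared. *)
Definition cond_symmetric (G : set (set T)) (Y : T -> X) : Prop :=
  exists k k' : R.-pker (g_sigma_algebraType G) ~> borel X,
    [/\ is_cond_distribution Y k,
        is_cond_distribution (fun w => - Y w) k' &
        {ae P, forall w, forall B : set (borel X),
          measurable B -> k w B = k' w B}].

Definition filtration (F : nat -> set (set T)) : Prop :=
  [/\ forall n, sigma_algebra [set: T] (F n),
      forall n, F n `<=` measurable &
      forall m n, (m <= n)%N -> F m `<=` F n].

Definition martingale (F : nat -> set (set T)) (f : nat -> T -> X) : Prop :=
  [/\ filtration F,
      forall n, measurable_fun [set: g_sigma_algebraType (F n)]
        (f n : g_sigma_algebraType (F n) -> borel X),
      forall n, bochner_integrable (f n) &
      forall n, is_cond_expectation (F n) (f n.+1) (f n)].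

End Bochner.

Section Functionals.
Context {R : realType} {T : Type} {X : normedModType R}.
Implicit Type f : nat -> T -> X.

(* Used for j >= 1 only. *)
Definition increment f (j : nat) (w : T) : X := f j w - f j.-1 w.

Definition maximal_fun f (w : T) : \bar R :=
  ereal_sup (range (fun j => (`|f j w|)%:E)).

Definition square_fun f (w : T) : \bar R :=
  sqrte (\sum_(1 <= j <oo) (`|increment f j w| ^+ 2)%:E)%E.

End Functionals.

(* Main.v *)
Require Import Defs.
From HB Require Import structures.
From mathcomp Require Import all_boot all_order all_algebra.
From mathcomp Require Import all_classical all_reals all_analysis.
From mathcomp Require Import measurable_realfun.
From mathcomp Require Import ring lra.

Set Implicit Arguments.
Unset Strict Implicit.
Unset Printing Implicit Defensive.

Import Order.TTheory GRing.Theory Num.Theory.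
Import numFieldNormedType.Exports.

Local Open Scope classical_set_scope.
Local Open Scope ring_scope.

(** Conditional symmetry of the increment d says that, given the past and the
    norm of d, the sign of d is a fair coin. So the expectation of a function
    of the past and of d does not change when that function is replaced by its
    mean over d and - d ([cond_symmetric_integral_le]).

    In a (2, D)-smooth space this makes the Gaussian weight
    exp (mu |f_n|^2 - nu s_n), where s_n is the sum of the squared norms of the
    increments, nonincreasing on average ([smooth2_exp_le]) as long as the path
    stays in a ball: mu = p / t^2 and nu of order p^2 D^2 / t^2 do for the ball
    of radius 4 t. Start the weight when |f_n| first exceeds t and stop it when
    |f_n| exceeds 4 t, or as soon as s_n exceeds a small multiple of
    t^2 / (p D^2). As a squared increment is at most s_n, the path cannot jump
    far, so it enters with |f_n| <= 2 t, that is with weight at most exp (4 p);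
    when it leaves through 4 t the weight is at least exp (15 p). Hence, up to
    the event that the square function exceeds a multiple of t / (sqrt p D),
    the probability of passing 4 t is at most exp (- 11 p) times that of passing
    t ([good_lambda_square]).

    Such a good-lambda inequality gives moments ([good_lambda_moment]): the
    factor exp (- 11 p) beats the factor 4^p between the p-th powers of the
    levels, so summing over levels in geometric progression bounds the p-th
    moment of the maximal function by that of sqrt p D times the square
    function, with an absolute constant. This is carried out up to a finite
    time and with finitely many levels, where all quantities are finite;
    monotone convergence removes both restrictions.

    The argument needs D >= 1, which holds unless the space is zero
    ([smooth2_ge1]). *)

(** * Exponential inequality in smooth spaces *)

(** A subgaussian bound on cosh z whose constant 2 in the exponent is not sharp,
    but for which 1 + x <= exp x suffices: for small z, bound exp (+- z) by
    1 / (1 -+ z); for large z, bound both exponentials by exp |z|. *)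
Lemma average_expR_le (R : realType) (z : R) :
  expR z + expR (- z) <= 2 * expR (2 * z ^+ 2).
Proof.
have [z_small|z_large] := leP (z ^+ 2) (2^-1).
- have inv_le (y : R) : y < 1 -> expR y <= (1 - y)^-1.
    move=> y1; rewrite -[y in expR y]opprK expRN lef_pV2 ?posrE ?expR_gt0 //;
      last by lra.
    by have := expR_ge1Dx (- y).
  have zlt1 : `|z| < 1.
    rewrite -(@ltr_pXn2r _ 2) ?nnegrE // ?expr1n real_normK ?num_real //; lra.
  move: zlt1; rewrite ltr_norml => /andP[z1 z2].
  have h1 := inv_le _ z2.
  have h2 : expR (- z) <= (1 - - z)^-1 by apply: inv_le; lra.
  apply: le_trans (lerD h1 h2) _.
  have -> : (1 - z)^-1 + (1 - - z)^-1 = 2 * (1 - z ^+ 2)^-1.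
    by field; apply/and3P; split; lra.
  rewrite ler_pM2l //; apply: le_trans (expR_ge1Dx _).
  rewrite invf_ple ?posrE; last 2 first.
  - by lra.
  - by have := sqr_ge0 z; lra.
  rewrite -[_^-1]mul1r ler_pdivrMr; last by have := sqr_ge0 z; lra.
  by have := sqr_ge0 z; nra.
- have zle : `|z| <= 2 * z ^+ 2.
    rewrite -(real_normK (num_real z)) in z_large *.
    by have := normr_ge0 z; nra.
  have le1 (y : R) : y <= `|z| -> expR y <= expR (2 * z ^+ 2).
    by move=> yz; rewrite ler_expR (le_trans yz).
  have := le1 z (ler_norm z).
  by have := le1 (- z); rewrite -normrN ler_norm => /(_ isT); lra.
Qed.

Section Smooth.
Context {R : realType} {X : normedModType R}.

(** Smoothness at the centre 0 reads 2 |x|^2 <= 2 D^2 |x|^2. *)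
Lemma smooth2_ge1 (D : R) (x : X) : 0 < D -> smooth2 X D -> x != 0 -> 1 <= D.
Proof.
move=> D0 sm x0; have := sm 0 x.
rewrite add0r sub0r normrN normr0 expr0n /= mulr0 add0r.
have x2_gt0 : 0 < `|x| ^+ 2 by rewrite exprn_gt0 ?normr_gt0.
move=> h; rewrite leNgt; apply/negP => D1.
have D2 : D ^+ 2 < 1 by rewrite exprn_ilt1 // ltW.
by have := ltr_pM2l x2_gt0 (D ^+ 2) 1; rewrite D2 => /idP; lra.
Qed.

(** The one place where the geometry of the space enters. With a = |x + y| and
    b = |x - y|, the mean of exp (m a^2) and exp (m b^2) is
    exp (m (a^2 + b^2) / 2) cosh (m (a^2 - b^2) / 2). Smoothness controls the
    first factor; the second is subgaussian in m (a - b) (a + b) / 2, where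
    |a - b| <= 2 |y| always and a + b <= 10 t on the region considered. With
    m = p / t^2 the cost of both factors is proportional to |y|^2, so that it
    can be charged to the square function. *)
Lemma smooth2_exp_le (D p t : R) (x y : X) :
    smooth2 X D -> 1 <= D -> 1 <= p -> 0 < t -> `|x| <= 4 * t -> `|y| <= t ->
  expR (p / t ^+ 2 * `|x + y| ^+ 2) + expR (p / t ^+ 2 * `|x - y| ^+ 2) <=
  2 * expR (p / t ^+ 2 * `|x| ^+ 2 + 225 * p ^+ 2 * D ^+ 2 / t ^+ 2 * `|y| ^+ 2).
Proof.
move=> sm D1 p1 t0 xt yt.
have := sm x y; set a := `|x + y|; set b := `|x - y|.
set u := `|x| in xt *; set v := `|y| in yt * => smxy.
have u0 : 0 <= u by exact: normr_ge0.
have v0 : 0 <= v by exact: normr_ge0.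
have a0 : 0 <= a by exact: normr_ge0.
have b0 : 0 <= b by exact: normr_ge0.
have ale : a <= u + v by exact: ler_normD.
have ble : b <= u + v by exact: ler_normB.
have yyE : y + y = (x + y) - (x - y).
  by rewrite opprB [y - x]addrC addrACA subrr add0r.
have vv : `|y + y| = 2 * v by rewrite -mulr2n normrMn mulr_natl.
have ab1 : a - b <= 2 * v.
  have := lerB_dist (x + y) (x - y); rewrite -yyE vv; exact.
have ab2 : b - a <= 2 * v.
  have := lerB_dist (x - y) (x + y); rewrite distrC -yyE vv; exact.
set m := p / t ^+ 2.
have m0 : 0 < m by rewrite divr_gt0 ?exprn_gt0 //; lra.
pose z := m * ((a ^+ 2 - b ^+ 2) / 2).
pose c := m * ((a ^+ 2 + b ^+ 2) / 2).
have -> : m * a ^+ 2 = c + z by rewrite /c /z; field.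
have -> : m * b ^+ 2 = c - z by rewrite /c /z; field.
rewrite !expRD -mulrDr.
have := ler_wpM2l (expR_ge0 c) (average_expR_le z).
move=> /le_trans; apply; rewrite mulrCA ler_pM2l // -!expRD ler_expR.
have zle : `|(a ^+ 2 - b ^+ 2) / 2| <= 10 * t * v.
  have -> : (a ^+ 2 - b ^+ 2) / 2 = (a - b) * ((a + b) / 2) by field.
  rewrite normrM (ger0_norm (x := (a + b) / 2)); last by lra.
  have -> : 10 * t * v = 2 * v * (5 * t) by ring.
  apply: ler_pM => //; [lra | by rewrite ler_norml; lra | lra].
have z2 : z ^+ 2 <= m ^+ 2 * (100 * t ^+ 2 * v ^+ 2).
  rewrite /z exprMn ler_pM2l ?exprn_gt0 //.
  rewrite -(real_normK (num_real (_ / 2))).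
  apply: (@le_trans _ _ ((10 * t * v) ^+ 2)).
    by rewrite ler_pXn2r ?nnegrE // !mulr_ge0 // ltW.
  by rewrite !exprMn; nra.
have cle : c <= m * (u ^+ 2 + D ^+ 2 * v ^+ 2).
  by rewrite /c ler_pM2l //; lra.
have -> : 225 * p ^+ 2 * D ^+ 2 / t ^+ 2 = 225 * p * D ^+ 2 * m.
  by rewrite /m; field; lra.
have mt : m ^+ 2 * (100 * t ^+ 2 * v ^+ 2) = 100 * p * (m * v ^+ 2).
  by rewrite /m; field; lra.
move: z2; rewrite mt => z2.
set w := m * v ^+ 2 in z2 *.
have w0 : 0 <= w by rewrite mulr_ge0 ?sqr_ge0 // ltW.
apply: (@le_trans _ _ (m * u ^+ 2 + D ^+ 2 * w + 200 * p * w)).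
  by move: cle z2; rewrite /w => cle z2; lra.
have -> : 225 * p * D ^+ 2 * m * v ^+ 2 = 225 * p * D ^+ 2 * w.
  by rewrite /w; ring.
rewrite -addrA lerD2l.
have D2 : 1 <= D ^+ 2 by rewrite exprn_ege1.
rewrite -mulrDl ler_wpM2r //.
have : 0 <= (p - 1) * (D ^+ 2) by rewrite mulr_ge0; lra.
have : 0 <= p * (D ^+ 2 - 1) by rewrite mulr_ge0; lra.
lra.
Qed.

End Smooth.

(** * Measurability in separable normed spaces *)

Lemma separable_sequence (R : realType) (X : normedModType R) :
  separable X ->
  exists e : nat -> X, forall x (r : R), 0 < r -> exists n, `|x - e n| < r.
Proof.
move=> [S + dS] => /pfcard_geP[S0|[e]].
  by have [|x []] := dS [set: X] _ openT; [exists 0|rewrite S0].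
exists e => x r r0.
have [|y [xy Sy]] := dS (ball x r) _ (ball_open x r).
  by exists x; exact: ballxx.
have [n _ ey] := 'surj_e Sy.
by exists n; move: xy; rewrite ey -ball_normE.
Qed.

Lemma measurable_ltr_set (R : realType) (d : measure_display)
    (T : measurableType d) (f g : T -> R) :
  measurable_fun [set: T] f -> measurable_fun [set: T] g ->
  measurable [set w | f w < g w].
Proof.
move=> mf mg; rewrite -[X in measurable X]setTI.
exact: measurable_fun_ltr mf mg measurableT [set true] _.
Qed.

Lemma measurable_ler_set (R : realType) (d : measure_display)
    (T : measurableType d) (f g : T -> R) :
  measurable_fun [set: T] f -> measurable_fun [set: T] g ->
  measurable [set w | f w <= g w].
Proof.
move=> mf mg; rewrite -[X in measurable X]setTI.
exact: measurable_fun_ler mf mg measurableT [set true] _.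
Qed.

(** In a separable space the Borel structure is determined by the countably many
    distances to the points of a dense sequence. This gives the measurability
    of sums, although the Borel structure of a product of two spaces is not a
    priori the product of their Borel structures. *)
Section Measurability.
Context {R : realType} {d : measure_display} {T : measurableType d}.
Context {X : normedModType R}.

Lemma measurable_norm_addl (g : T -> X) (c : X) :
  measurable_fun [set: T] (g : T -> borel X) ->
  measurable_fun [set: T] (fun w => `|c + g w|).
Proof.
move=> mg; apply: (measurability _ (RGenInftyO.measurableE R)).
move=> _ [_ [y ->] <-].
have -> : [set: T] `&` (fun w => `|c + g w|) @^-1` `]-oo, y[ =
    [set: T] `&` g @^-1` [set x | `|c + x| < y].
  by rewrite !setTI; apply/seteqP; split => w /=; rewrite in_itv.
apply: mg => //; apply: sub_sigma_algebra.
have -> : [set x | `|c + x| < y] = (fun x : X => `|c + x|) @^-1` [set z | z < y].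
  by [].
apply: open_comp; last exact: open_lt.
move=> x _; apply: cvg_norm; apply: cvgD; [exact: cvg_cst|exact: cvg_id].
Qed.

Let rad (k : nat) : R := k.+1%:R^-1.

Let rad_gt0 k : 0 < rad k. Proof. by rewrite invr_gt0. Qed.

Let rad_lt (r : R) : 0 < r -> exists k, rad k < r.
Proof. by move=> /ltr_add_invr[k]; rewrite add0r; exists k. Qed.

Hypothesis X_separable : separable X.

Lemma measurable_of_dist (g : T -> X) :
  (forall c, measurable_fun [set: T] (fun w => `|c + g w|)) ->
  measurable_fun [set: T] (g : T -> borel X).
Proof.
move=> mg; have [e e_dense] := separable_sequence X_separable.
apply: (@measurability _ _ _ (borel X) _ _ (@open X)) => //.
move=> _ [U oU <-]; rewrite setTI.
have -> : g @^-1` U = \bigcup_n \bigcup_(k in [set k : nat |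
    forall x, `|x - e n| < rad k -> U x])
    [set w | `|- e n + g w| < rad k].
  apply/seteqP; split => [w /= Ugw|w [n _ [k /= nkU gw]]].
    have /nbhs_ballP[r /= r0 rU] : nbhs (g w) U by exact: open_nbhs_nbhs.
    have [k kr] := rad_lt (r := r / 2) ltac:(by rewrite divr_gt0).
    have [n en] := e_dense (g w) (rad k) (rad_gt0 k).
    exists n => //; exists k; last by rewrite /= addrC.
    move=> x /= xe; apply: rU; rewrite -ball_normE /=.
    rewrite -(subrKA (e n)) (le_lt_trans (ler_normD _ _)) //.
    rewrite [`|e n - x|]distrC (lt_trans (ltrD en xe)) //.
    by rewrite [ltRHS]splitr; exact: ltrD.
  by apply: nkU; rewrite addrC.
apply: bigcup_measurable => n _; apply: bigcup_measurable => k _.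
exact: measurable_ltr_set (mg (- e n)) (measurable_cst _).
Qed.

(** The norm |c + f + g| is the infimum of |c + e n + f| + |g - e n| over a dense
    sequence e, so its sublevel sets are countable unions of intersections of
    an event about f with an event about g. *)
Lemma measurable_norm_add (f g : T -> X) (c : X) :
  measurable_fun [set: T] (f : T -> borel X) ->
  measurable_fun [set: T] (g : T -> borel X) ->
  measurable_fun [set: T] (fun w => `|c + (f w + g w)|).
Proof.
move=> mf mg; have [e e_dense] := separable_sequence X_separable.
apply: (measurability _ (RGenInftyO.measurableE R)) => _ [_ [y ->] <-].
have -> : [set: T] `&` (fun w => `|c + (f w + g w)|) @^-1` `]-oo, y[ =
    \bigcup_n \bigcup_k ([set w | `|c + e n + f w| < y - rad k] `&`
      [set w | `|- e n + g w| < rad k]).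
  rewrite setTI; apply/seteqP; split => w /=; rewrite in_itv /=.
    move=> fgy.
    have [k ky] := rad_lt
      (r := (y - `|c + (f w + g w)|) / 2) ltac:(by rewrite divr_gt0 // subr_gt0).
    have [n en] := e_dense (g w) (rad k) (rad_gt0 k).
    exists n => //; exists k => //; split; last by rewrite /= addrC.
    rewrite /=; have -> : c + e n + f w = c + (f w + g w) - (g w - e n).
      by rewrite opprB addrACA addrK.
    rewrite /= (le_lt_trans (ler_normB _ _)) // ltrBrDr -addrA.
    move: (ltrD en en) ky; set a := `|c + _|.
    by set b := `|g w - e n|; lra.
  move=> [n _ [k _ /= [cef eg]]].
  have -> : c + (f w + g w) = c + e n + f w + (- e n + g w).
    by rewrite [RHS]addrACA addrK.
  rewrite (le_lt_trans (ler_normD _ _)) // (lt_le_trans (ltrD cef eg)) //.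
  by rewrite subrK.
apply: bigcup_measurable => n _; apply: bigcup_measurable => k _.
apply: measurableI; apply: measurable_ltr_set => //; exact: measurable_norm_addl.
Qed.

Lemma measurable_borelD (f g : T -> X) :
  measurable_fun [set: T] (f : T -> borel X) ->
  measurable_fun [set: T] (g : T -> borel X) ->
  measurable_fun [set: T] ((fun w => f w + g w) : T -> borel X).
Proof.
by move=> mf mg; apply: measurable_of_dist => c; exact: measurable_norm_add.
Qed.

Lemma measurable_borelN (f : T -> X) :
  measurable_fun [set: T] (f : T -> borel X) ->
  measurable_fun [set: T] ((fun w => - f w) : T -> borel X).
Proof.
move=> mf; apply: measurable_of_dist => c.
under eq_fun do rewrite -normrN opprD opprK.
exact: measurable_norm_addl.
Qed.

End Measurability.

Lemma measurable_norm (R : realType) (d : measure_display)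
    (T : measurableType d) (X : normedModType R) (g : T -> X) :
  measurable_fun [set: T] (g : T -> borel X) ->
  measurable_fun [set: T] (fun w => `|g w|).
Proof.
by move=> /(measurable_norm_addl 0); under eq_fun do rewrite add0r.
Qed.

(** * Conditionally symmetric vectors *)

Section ConditionalSymmetry.
Context {R : realType} {d : measure_display} {T : measurableType d}.
Context {X : completeNormedModType R} (P : probability T R).
Hypothesis X_separable : separable X.
Variables (G : set (set T)) (Y : T -> X).
Hypotheses (G_measurable : G `<=` measurable)
  (G_sigma : sigma_algebra [set: T] G).
Hypothesis mY : measurable_fun [set: T] (Y : T -> borel X).

Lemma measurable_id_sub :
  measurable_fun [set: T] (id : T -> g_sigma_algebraType G).
Proof.
move=> _ A mA; rewrite setTI; apply: G_measurable.
by rewrite -(sigma_algebra_id G_sigma); exact: mA.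
Qed.

(** Conditional symmetry is used only through this consequence: the joint law of
    Y with any G-measurable data is unchanged when Y is replaced by - Y. *)
Lemma cond_symmetric_rectangle (A : set T) (B : set (borel X)) :
  cond_symmetric P G Y -> G A -> measurable B ->
  P (A `&` Y @^-1` B) = P (A `&` (fun w => - Y w) @^-1` B).
Proof.
move=> [k [k' [kY k'Y kk']]] GA mB; rewrite -kY // -k'Y //.
have mk (l : R.-pker (g_sigma_algebraType G) ~> borel X) :
    measurable_fun A (fun w => l w B).
  apply/measurable_funTS.
  exact: measurableT_comp (measurable_kernel l B mB) measurable_id_sub.
apply: ae_eq_integral => //; first exact: G_measurable.
apply: (@filterS _ _ (ae_filter_ringOfSetsType P)) kk' => w kw _; exact: kw.
Qed.

(** The joint laws of (w, Y w) and (w, - Y w) on the product of (T, G) with X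
    agree on rectangles, which form a generating pi-system. *)
Lemma cond_symmetric_integral (h : g_sigma_algebraType G * borel X -> \bar R) :
  cond_symmetric P G Y -> measurable_fun setT h -> (forall z, 0 <= h z)%E ->
  (\int[P]_w h (w, Y w) = \int[P]_w h (w, (- Y w)%R))%E.
Proof.
move=> symY mh h0.
pose phi (Z : T -> X) w : g_sigma_algebraType G * borel X := (w, Z w).
have mphi (Z : T -> X) : measurable_fun [set: T] (Z : T -> borel X) ->
    measurable_fun [set: T] (phi Z).
  by move=> mZ; apply: measurable_fun_pair => //; exact: measurable_id_sub.
have mNY := measurable_borelN X_separable mY.
pose law Z (mZ : measurable_fun [set: T] (Z : T -> borel X)) :
    {measure set (g_sigma_algebraType G * borel X) -> \bar R} :=
  measure_function_pushforward__canonical__measure_function_Measure P (mphi Z mZ).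
have eq_law C : measurable C -> law Y mY C = law (fun w => - Y w) mNY C.
  move=> mC.
  apply: (measure_unique _ (fun=> setT) (measurable_prod_measurableType _ _)
    _ _ _ (law Y mY) (law _ mNY)) => //.
  - move=> _ _ [A1 mA1 [B1 mB1 <-]] [A2 mA2 [B2 mB2 <-]].
    exists (A1 `&` A2); first exact: measurableI.
    by exists (B1 `&` B2); [exact: measurableI | rewrite setXI].
  - by move=> _ /=; exists setT; [|exists setT; rewrite ?setXTT].
  - by rewrite bigcup_const.
  - move=> _ [A mA [B mB <-]]; apply: cond_symmetric_rectangle => //.
    by rewrite -(sigma_algebra_id G_sigma); exact: mA.
  - move=> _; change (P (phi Y @^-1` setT) < +oo)%E.
    by rewrite preimage_setT probability_setT ltry.
have integral_law Z mZ : (\int[P]_w h (w, Z w) = \int[law Z mZ]_z h z)%E.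
  by rewrite (ge0_integral_pushforward (mphi Z mZ)).
rewrite (integral_law _ mY) (integral_law _ mNY).
by apply: eq_measure_integral => C mC _; exact: eq_law.
Qed.

(** What replaces conditioning on G and on the norm of Y: a function whose mean
    over the two signs of y is dominated by a function of the past w integrates
    to at most that function. Everything is nonnegative, so there is no
    integrability to check. *)
Lemma cond_symmetric_integral_le (h : g_sigma_algebraType G * borel X -> R)
    (g : T -> R) :
  cond_symmetric P G Y -> measurable_fun setT h -> (forall z, 0 <= h z) ->
  measurable_fun setT g -> (forall w, 0 <= g w) ->
  (forall w (y : X), h (w, y) + h (w, - y) <= 2 * g w) ->
  (\int[P]_w (h (w, Y w))%:E <= \int[P]_w (g w)%:E)%E.
Proof.
move=> symY mh h0 mg g0 hg.
pose H z := (h z)%:E.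
have mH : measurable_fun setT H by apply/measurable_EFinP.
have H0 z : (0 <= H z)%E by rewrite lee_fin.
have mgraph (Z : T -> X) : measurable_fun [set: T] (Z : T -> borel X) ->
    measurable_fun [set: T] (fun w => H (w, Z w)).
  move=> mZ; apply: (measurableT_comp (f := H) mH).
  by apply: measurable_fun_pair => //; exact: measurable_id_sub.
have mNY := measurable_borelN X_separable mY.
have twice_le : (\int[P]_w (H (w, Y w) + H (w, - Y w)%R) <=
    \int[P]_w (2%:E * (g w)%:E))%E.
  apply: ge0_le_integral => //.
  - by move=> w _; apply: adde_ge0.
  - by apply: emeasurable_funD; apply: mgraph.
  - by apply/measurable_EFinP; apply: measurable_funM.
  - by move=> w _; rewrite -EFinD -EFinM lee_fin.
move: twice_le; rewrite ge0_integralD //; [|exact: mgraph|exact: mgraph].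
rewrite -(cond_symmetric_integral symY mH H0) ge0_integralZl_EFin //; last 2 first.
- by move=> w _; rewrite lee_fin.
- exact/measurable_EFinP.
rewrite -[X in (X + X)%E]mul1e -ge0_muleDl // -EFinD.
by rewrite (_ : 1 + 1 = 2 :> R) // lee_pmul2l.
Qed.

End ConditionalSymmetry.

(** * Good-lambda inequality for the running maximum *)

Section RunningFunctionals.
Context {R : realType} {X : normedModType R}.

Fixpoint running_max {T : Type} (f : nat -> T -> X) n w : R :=
  if n is m.+1 then Num.max (running_max f m w) `|f n w| else `|f 0 w|.

Definition square_sum {T : Type} (f : nat -> T -> X) n w : R :=
  \sum_(1 <= j < n.+1) `|increment f j w| ^+ 2.

Section Recursion.
Context {T : Type} (f : nat -> T -> X).

Lemma running_maxS n w :
  running_max f n.+1 w = Num.max (running_max f n w) `|f n.+1 w|.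
Proof. by []. Qed.

Lemma running_max0 w : f 0%N w = 0 -> running_max f 0%N w = 0.
Proof. by rewrite /= => ->; exact: normr0. Qed.

Lemma norm_le_running_max n w : `|f n w| <= running_max f n w.
Proof. by case: n => //= n; rewrite le_max lexx orbT. Qed.

Lemma running_max_ge0 n w : 0 <= running_max f n w.
Proof. exact: le_trans (normr_ge0 _) (norm_le_running_max n w). Qed.

Lemma running_max_homo w :
  {homo (running_max f ^~ w) : m n / (m <= n)%N >-> m <= n}.
Proof.
apply: homo_leq => //; first exact: le_trans.
by move=> n; rewrite running_maxS le_max lexx.
Qed.

Lemma square_sum0 w : square_sum f 0 w = 0.
Proof. by rewrite /square_sum big_geq. Qed.

Lemma square_sumS n w :
  square_sum f n.+1 w = square_sum f n w + `|f n.+1 w - f n w| ^+ 2.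
Proof. by rewrite /square_sum big_nat_recr. Qed.

Lemma square_sum_ge0 n w : 0 <= square_sum f n w.
Proof. by apply: sumr_ge0 => j _; exact: sqr_ge0. Qed.

End Recursion.

Section Measurability.
Context {d : measure_display} {T : measurableType d}.
Variables (f : nat -> T -> X) (n : nat).
Hypothesis mf : forall j, (j <= n)%N ->
  measurable_fun [set: T] (f j : T -> borel X).

Lemma measurable_running_max : measurable_fun [set: T] (running_max f n).
Proof.
have m_norm j : (j <= n)%N -> measurable_fun [set: T] (fun w => `|f j w|).
  by move=> jn; apply: measurable_norm; exact: mf.
elim: n m_norm => [m_norm|m IH m_norm].
  exact: m_norm.
apply: measurable_maxr; last exact: m_norm.
by apply: IH => j jm; apply: m_norm; exact: leqW.
Qed.

Lemma measurable_square_sum : separable X ->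
  measurable_fun [set: T] (square_sum f n).
Proof.
move=> X_separable; elim: n mf => [_|m IH mf'].
  have -> : square_sum f 0 = cst 0 by apply/funext => w; exact: square_sum0.
  exact: measurable_cst.
have -> : square_sum f m.+1 =
    square_sum f m \+ (fun w => `|f m.+1 w - f m w| ^+ 2).
  by apply/funext => w; exact: square_sumS.
apply: measurable_funD; first by apply: IH => j jm; apply: mf'; exact: leqW.
apply: measurable_funX; apply: measurable_norm.
apply: measurable_borelD => //; first exact: mf'.
by apply: measurable_borelN => //; exact: mf'.
Qed.

End Measurability.
End RunningFunctionals.

Section GoodLambda.
Context {R : realType} {X : completeNormedModType R} (D : R).
Hypotheses (X_separable : separable X) (X_smooth : smooth2 X D) (D_ge1 : 1 <= D).
Context {d : measure_display} {T : measurableType d} (P : probability T R).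
Context (F : nat -> set (set T)) (f : nat -> T -> X).
Hypothesis F_filtration : filtration F.
Hypothesis f_adapted : forall n, measurable_fun [set: g_sigma_algebraType (F n)]
  (f n : g_sigma_algebraType (F n) -> borel X).
Hypothesis f0 : forall w, f 0%N w = 0.
Hypothesis f_symmetric : forall j : nat, (1 <= j)%N ->
  cond_symmetric P (F j.-1) (increment f j).

Let sF n : sigma_algebra [set: T] (F n). Proof. by case: F_filtration. Qed.
Let Fm n : F n `<=` measurable. Proof. by case: F_filtration. Qed.

Lemma adapted_le j n : (j <= n)%N ->
  measurable_fun [set: g_sigma_algebraType (F n)]
  (f j : g_sigma_algebraType (F n) -> borel X).
Proof.
move=> jn _ B mB; apply: sub_sigma_algebra.
have [_ _ /(_ _ _ jn)] := F_filtration; apply.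
by rewrite -(sigma_algebra_id (sF j)); exact: f_adapted.
Qed.

Lemma adapted_measurable n : measurable_fun [set: T] (f n : T -> borel X).
Proof.
move=> _ B mB; apply: (Fm (n := n)).
by rewrite -(sigma_algebra_id (sF n)); exact: f_adapted.
Qed.

Lemma measurable_increment n :
  measurable_fun [set: T] (increment f n : T -> borel X).
Proof.
apply: measurable_borelD => //; first exact: adapted_measurable.
by apply: measurable_borelN => //; exact: adapted_measurable.
Qed.

Variables (p t : R).
Hypotheses (p_ge1 : 1 <= p) (t_gt0 : 0 < t).

(* b is the level that the square sum may reach before the path is discarded; it is chosen so that the compensator nu * b equals p, and it
   satisfies b <= t ^+ 2, so that no admissible jump exceeds t. *)
Let mu := p / t ^+ 2.
Let nu := 225 * p ^+ 2 * D ^+ 2 / t ^+ 2.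
Let b := t ^+ 2 / (225 * p * D ^+ 2).
Let U (x s : R) := expR (mu * x ^+ 2 - nu * s).
Let M := running_max f.
Let s := square_sum f.

(* L follows a path from the time its norm passes t on: it is the Gaussian
   weight U while the norm stays below 4 t, it freezes at the lower bound
   exp (15 p) of U once 4 t is passed, and it vanishes when the square sum
   exceeds b. *)
Let L n w : R :=
  if (t < M n w) && (s n w <= b) then
    if M n w <= 4 * t then U `|f n w| (s n w) else expR (15 * p)
  else 0.

(* An upper bound of L n.+1 on the paths that have already passed t, written as
   a function of the past and of the next increment so that the sign of the
   latter can be averaged. *)
Let h n (z : T * X) : R :=
  if (t < M n z.1) && (s n z.1 + `|z.2| ^+ 2 <= b) then
    if M n z.1 <= 4 * t then
      U `|f n z.1 + z.2| (s n z.1 + `|z.2| ^+ 2)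
    else expR (15 * p)
  else 0.

Let L_ge0 n w : 0 <= L n w.
Proof. by rewrite /L; case: ifP => // _; case: ifP => // _; exact: expR_ge0. Qed.

Let h_ge0 n z : 0 <= h n z.
Proof. by rewrite /h; case: ifP => // _; case: ifP => // _; exact: expR_ge0. Qed.

Let p_gt0 : 0 < p. Proof. exact: lt_le_trans p_ge1. Qed.

Let D2_ge1 : 1 <= D ^+ 2. Proof. by rewrite exprn_ege1. Qed.

Let nu_ge0 : 0 <= nu.
Proof.
apply: divr_ge0; last exact: sqr_ge0.
apply: mulr_ge0; last exact: sqr_ge0.
by apply: mulr_ge0; [exact: ler0n | exact: sqr_ge0].
Qed.

Let nu_b : nu * b = p.
Proof.
rewrite /nu /b; field; apply/and3P; split; apply: lt0r_neq0 => //.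
exact: lt_le_trans D_ge1.
Qed.

Let b_le : b <= t ^+ 2.
Proof.
rewrite /b ler_pdivrMr; last first.
  apply: mulr_gt0; last exact: lt_le_trans D2_ge1.
  by apply: mulr_gt0; [exact: ltr0n | exact: p_gt0].
rewrite ler_peMr ?sqr_ge0 //.
have : 1 * 1 <= p * D ^+ 2 by apply: ler_pM.
by lra.
Qed.

(* 16 p comes from mu * (4 t) ^+ 2, and p from nu * b. *)
Let U_large x y : 4 * t <= x -> y <= b -> expR (15 * p) <= U x y.
Proof.
move=> tx yb; rewrite ler_expR.
have nuy : nu * y <= p by rewrite -nu_b ler_wpM2l.
have : mu * (4 * t) ^+ 2 <= mu * x ^+ 2.
  rewrite ler_wpM2l ?divr_ge0 ?sqr_ge0 ?(ltW p_gt0) // ler_pXn2r ?nnegrE //;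
  by have := t_gt0; lra.
have -> : mu * (4 * t) ^+ 2 = 16 * p by rewrite /mu; field; exact: lt0r_neq0.
by lra.
Qed.

Let U_small x y : 0 <= x -> x <= 2 * t -> 0 <= y -> U x y <= expR (4 * p).
Proof.
move=> x0 xt y0; rewrite ler_expR.
have nuy : 0 <= nu * y by rewrite mulr_ge0.
have : mu * x ^+ 2 <= mu * (2 * t) ^+ 2.
  rewrite ler_wpM2l ?divr_ge0 ?sqr_ge0 ?(ltW p_gt0) // ler_pXn2r ?nnegrE //;
  by have := t_gt0; lra.
have -> : mu * (2 * t) ^+ 2 = 4 * p by rewrite /mu; field; exact: lt0r_neq0.
by lra.
Qed.

Let norm_le_of_sq (x : R) : 0 <= x -> x ^+ 2 <= b -> x <= t.
Proof.
move=> x0 xb; rewrite -(@ler_pXn2r _ 2) ?nnegrE //; first exact: le_trans b_le.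
exact: ltW.
Qed.

Let h_average n w y : h n (w, y) + h n (w, - y) <= 2 * L n w.
Proof.
rewrite /h /= normrN; case: ifP => [/andP[tM sb]|_]; last first.
  by rewrite addr0 mulr_ge0.
have y2_ge0 := sqr_ge0 `|y|.
have sb' : s n w <= b by lra.
rewrite /L tM sb' /=; case: ifP => M4; last by lra.
have y_le : `|y| <= t.
  by apply: norm_le_of_sq => //; have := square_sum_ge0 f n w; rewrite -/s; lra.
have x_le : `|f n w| <= 4 * t by apply: le_trans M4; exact: norm_le_running_max.
have := smooth2_exp_le X_smooth D_ge1 p_ge1 t_gt0 x_le y_le.
rewrite -/mu -/nu => key; rewrite /U !expRD -mulrDl.
rewrite (le_trans (ler_wpM2r (expR_ge0 _) key)) // -mulrA -!expRD.
by rewrite ler_pM2l // ler_expR; lra.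
Qed.

(* Paths that pass t between n and n.+1 jump by at most t, hence enter with norm
   at most 2 t and weight at most exp (4 p). *)
Let L_step n w :
  L n.+1 w <= h n (w, increment f n.+1 w) +
              (if (M n w <= t) && (t < M n.+1 w) then expR (4 * p) else 0).
Proof.
have cross_ge0 :
    0 <= (if (M n w <= t) && (t < M n.+1 w) then expR (4 * p) else 0).
  by case: ifP => // _; exact: expR_ge0.
rewrite {1}/L; case: ifP => [/andP[tM sb]|_]; last by rewrite addr_ge0.
rewrite tM andbT /h /=.
have sE : s n w + `|increment f n.+1 w| ^+ 2 = s n.+1 w.
  by rewrite /s square_sumS.
have fE : f n w + increment f n.+1 w = f n.+1 w.
  by rewrite /increment /= addrC subrK.
rewrite sE fE sb andbT.
have step_le : `|increment f n.+1 w| <= t.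
  apply: norm_le_of_sq => //; rewrite (le_trans _ sb) // -sE.
  by rewrite lerDr square_sum_ge0.
have MS : M n.+1 w = Num.max (M n w) `|f n.+1 w| by exact: running_maxS.
have [Mt|Mt] := leP (M n w) t.
  rewrite add0r; have f_le : `|f n.+1 w| <= 2 * t.
    rewrite -fE (le_trans (ler_normD _ _)) // mulr_natl mulr2n lerD //.
    by rewrite (le_trans (norm_le_running_max _ _ _)).
  have -> : M n.+1 w <= 4 * t by rewrite MS ge_max; have := t_gt0; lra.
  by apply: U_small => //; exact: square_sum_ge0.
rewrite addr0 MS ge_max; case: (leP (M n w) (4 * t)) => //= M4.
by case: (leP `|f n.+1 w| (4 * t)) => // f4; apply: U_large => //; exact: ltW.
Qed.

Let measurable_L n : measurable_fun [set: T] (L n).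
Proof.
have mM : measurable_fun [set: T] (M n).
  by apply: measurable_running_max => j _; exact: adapted_measurable.
have ms : measurable_fun [set: T] (s n).
  by apply: measurable_square_sum => // j _; exact: adapted_measurable.
apply: measurable_fun_ifT => //.
  apply: measurable_and; first exact: measurable_fun_ltr.
  exact: measurable_fun_ler.
apply: measurable_fun_ifT => //; first exact: measurable_fun_ler.
apply: measurableT_comp => //; apply: measurable_funB.
  apply: measurable_funM => //; apply: measurable_funX.
  exact: measurable_norm (adapted_measurable n).
exact: measurable_funM.
Qed.

Let measurable_h n :
  measurable_fun [set: g_sigma_algebraType (F n) * borel X]
    (h n : g_sigma_algebraType (F n) * borel X -> R).
Proof.
pose Z := (g_sigma_algebraType (F n) * borel X)%type.
have mM : measurable_fun [set: Z] (fun z : Z => M n z.1).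
  apply: (measurableT_comp (f := (M n : g_sigma_algebraType (F n) -> R))) => //.
  by apply: measurable_running_max => j jn; exact: adapted_le.
have ms : measurable_fun [set: Z] (fun z : Z => s n z.1).
  apply: (measurableT_comp (f := (s n : g_sigma_algebraType (F n) -> R))) => //.
  by apply: measurable_square_sum => // j jn; exact: adapted_le.
have my : measurable_fun [set: Z] (fun z : Z => `|z.2 : X| ^+ 2).
  apply: measurable_funX.
  apply: (measurable_norm (T := Z) (g := fun z : Z => z.2 : X)).
  exact: measurable_snd.
have mfy : measurable_fun [set: Z] (fun z : Z => `|f n z.1 + (z.2 : X)| ^+ 2).
  apply: measurable_funX.
  apply: (measurable_norm (T := Z) (g := fun z : Z => f n z.1 + (z.2 : X))).
  apply: (measurable_borelD (T := Z) X_separable (f := fun z : Z => f n z.1)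
    (g := fun z : Z => z.2 : X)); last exact: measurable_snd.
  exact: (measurableT_comp (@f_adapted n) measurable_fst).
have msy := measurable_funD ms my.
apply: measurable_fun_ifT => //.
  apply: measurable_and; first exact: measurable_fun_ltr.
  exact: measurable_fun_ler.
apply: measurable_fun_ifT => //; first exact: measurable_fun_ler.
apply: measurableT_comp => //; apply: measurable_funB; exact: measurable_funM.
Qed.

Let integral_h_le n :
  (\int[P]_w (h n (w, increment f n.+1 w))%:E <= \int[P]_w (L n w)%:E)%E.
Proof.
apply: (cond_symmetric_integral_le X_separable (@Fm n)
  (sF n) (measurable_increment n.+1) (@f_symmetric n.+1 isT)
  (h := h n) (g := L n)).
- exact: measurable_h.
- exact: h_ge0.
- exact: measurable_L.
- exact: L_ge0.
- exact: h_average.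
Qed.

Let exceed n := [set w | t < M n w].

Let measurable_exceed n : measurable (exceed n).
Proof.
have mM : measurable_fun [set: T] (M n).
  by apply: measurable_running_max => j _; exact: adapted_measurable.
exact: measurable_ltr_set.
Qed.

Let integral_L_le n :
  (\int[P]_w (L n w)%:E <= (expR (4 * p))%:E * P (exceed n))%E.
Proof.
elim: n => [|n IH].
  rewrite (eq_integral (cst 0%E)) ?integral0 ?mule_ge0 ?lee_fin ?expR_ge0 //.
  by move=> w _; rewrite /L /M running_max0 // ltNge (ltW t_gt0).
pose J w := (h n (w, increment f n.+1 w))%:E.
pose cross := exceed n.+1 `\` exceed n.
have m_cross : measurable cross by apply: measurableD; exact: measurable_exceed.
have mJ : measurable_fun [set: T] J.
  apply/measurable_EFinP.
  pose graph w : g_sigma_algebraType (F n) * borel X := (w, increment f n.+1 w).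
  have m_graph : measurable_fun [set: T] graph.
    apply: measurable_fun_pair; last exact: measurable_increment.
    exact: measurable_id_sub (@Fm n) (sF n).
  exact: (measurableT_comp (@measurable_h n) m_graph).
have J0 w : (0 <= J w)%E by rewrite lee_fin.
have K0 w : (0 <= (expR (4 * p) * \1_cross w)%:E)%E.
  by rewrite lee_fin mulr_ge0 ?expR_ge0.
have mK : measurable_fun [set: T] (fun w => (expR (4 * p) * \1_cross w)%:E).
  by apply/measurable_EFinP; apply: measurable_funM.
apply: (@le_trans _ _ (\int[P]_w (J w + (expR (4 * p) * \1_cross w)%:E))%E).
  apply: ge0_le_integral => //.
  - by move=> w _; rewrite lee_fin.
  - by apply/measurable_EFinP; exact: measurable_L.
  - exact: emeasurable_funD.
  - move=> w _; rewrite /J -EFinD lee_fin (le_trans (L_step n w)) // lerD2l.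
    rewrite indicE; case: ifP => [/andP[Mt tM]|_].
      by rewrite mem_set ?mulr1 //; split => //=; apply/negP; rewrite -leNgt.
    by rewrite mulr_ge0 ?expR_ge0.
rewrite ge0_integralD //.
under [X in (_ + X)%E]eq_integral do rewrite EFinM.
rewrite ge0_integralZl_EFin ?expR_ge0 //; last first.
  by apply/measurable_EFinP.
rewrite integral_indic // setIT.
have -> : exceed n.+1 = cross `|` exceed n.
  rewrite setUC setDUK //; move=> w /= tM; apply: lt_le_trans tM _.
  exact: (running_max_homo f w (leqnSn n)).
rewrite measureU //; last by rewrite /cross setDKI.
rewrite ge0_muleDr; [|exact: measure_ge0|exact: measure_ge0].
rewrite addeC; apply: leeD; first exact: lexx.
exact: le_trans (integral_h_le n) IH.
Qed.

(** Let the exponential weight L run from the passage of t to that of 4 t: it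
    starts below exp (4 p), does not increase on average, and ends above
    exp (15 p) unless the square sum has become large. The gap between the two
    exponents comes from the factor 4 between the two levels. *)
Lemma good_lambda_square n :
  ((expR (15 * p))%:E * P [set w | (4 * t < running_max f n w)%R /\
                          (square_sum f n w <= t ^+ 2 / (225 * p * D ^+ 2))%R]
   <= (expR (4 * p))%:E * P [set w | (t < running_max f n w)%R])%E.
Proof.
rewrite -/M -/s -/b.
apply: le_trans (integral_L_le n).
have mM : measurable_fun [set: T] (M n).
  by apply: measurable_running_max => j _; exact: adapted_measurable.
have ms : measurable_fun [set: T] (s n).
  by apply: measurable_square_sum => // j _; exact: adapted_measurable.
set C := [set w | _ /\ _].
have mC : measurable C.
  by apply: measurableI; [exact: measurable_ltr_set | exact: measurable_ler_set].
have -> : P C = (\int[P]_w (\1_C w)%:E)%E by rewrite integral_indic // setIT.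
rewrite -ge0_integralZl_EFin ?expR_ge0 //; last by apply/measurable_EFinP.
apply: ge0_le_integral => //.
- by apply/measurable_EFinP; apply: measurable_funM.
- by apply/measurable_EFinP; exact: measurable_L.
move=> w _; rewrite -EFinM lee_fin indicE.
have [/set_mem[tM sb]|_] := boolP (w \in C); last by rewrite mulr0.
rewrite mulr1 /L sb andbT (leNgt (M n w)) tM /=.
have -> // : t < M n w by apply: lt_trans tM; have := t_gt0; lra.
Qed.

End GoodLambda.

(** * From good-lambda inequalities to moments *)

Section GoodLambdaMoments.
Context {R : realType} (p : R).
Hypothesis p_ge1 : 1 <= p.

Let q : R := 4 `^ p.

Let p_ge0 : 0 <= p. Proof. exact: le_trans p_ge1. Qed.

Let q_ge4 : 4 <= q.
Proof. by rewrite /q -[leLHS]powRr1 // ler_powR //; lra. Qed.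

Let q_gt0 : 0 < q. Proof. by have := q_ge4; lra. Qed.

Let powR_scale (tau : R) n : 0 <= tau ->
  (4 ^+ n * tau) `^ p = q ^+ n * tau `^ p.
Proof.
move=> tau0; elim: n => [|n IH]; first by rewrite !expr0 !mul1r.
by rewrite !exprS -!mulrA powRM ?mulr_ge0 ?exprn_ge0 // IH.
Qed.

(** A discrete layer-cake substitute for the p-th power of x, with levels in
    geometric progression of ratio 4 starting at tau. Having finitely many
    levels keeps its expectation finite, which allows it to be absorbed into
    the left-hand side of an inequality. *)
Definition layer_sum (tau : R) n (x : R) : R :=
  \sum_(i < n) (4 `^ p) ^+ i * (4 ^+ i * tau < x)%R%:R.

Lemma layer_sum_ge0 (tau : R) n (x : R) : 0 <= layer_sum tau n x.
Proof. by apply: sumr_ge0 => i _; rewrite mulr_ge0 ?exprn_ge0 // powR_ge0. Qed.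

Lemma powR_le_layer_sum (tau : R) n (x : R) : 0 < tau -> 0 <= x ->
  Num.min x (4 ^+ n * tau) `^ p <=
  tau `^ p + 4 `^ p * tau `^ p * layer_sum tau n x.
Proof.
move=> tau0 x0; rewrite -/q; have tau_ge0 := ltW tau0.
have tp_ge0 : 0 <= tau `^ p by exact: powR_ge0.
elim: n => [|n IH].
  rewrite /layer_sum big_ord0 mulr0 addr0 expr0 mul1r.
  by rewrite ge0_ler_powR ?nnegrE ?le_min ?x0 ?tau_ge0 // ge_min lexx orbT.
have min_ge0 : 0 <= Num.min x (4 ^+ n.+1 * tau).
  by rewrite le_min x0 mulr_ge0 // exprn_ge0.
rewrite /layer_sum big_ord_recr /= -/q -/(layer_sum tau n x).
have S0 := layer_sum_ge0 tau n x.
have [xlarge|xsmall] := ltP (4 ^+ n * tau) x.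
  apply: (@le_trans _ _ ((4 ^+ n.+1 * tau) `^ p)).
    by rewrite ge0_ler_powR ?nnegrE ?mulr_ge0 ?exprn_ge0 // ge_min lexx orbT.
  rewrite powR_scale // mulr1 mulrDr exprS.
  have : 0 <= q * tau `^ p * layer_sum tau n x by rewrite !mulr_ge0 // ltW.
  by lra.
rewrite mulr0 addr0; apply: le_trans IH.
rewrite ge0_ler_powR ?nnegrE // ?le_min ?x0 ?mulr_ge0 ?exprn_ge0 //.
by rewrite !ge_min lexx /= xsmall.
Qed.

Lemma layer_sum_le_powR (tau : R) n (x : R) : 0 < tau -> 0 <= x ->
  tau `^ p * layer_sum tau n x <= 2 * x `^ p.
Proof.
move=> tau0 x0.
have tp_ge0 : 0 <= tau `^ p by exact: powR_ge0.
elim: n => [|n IH].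
  by rewrite /layer_sum big_ord0 mulr0 mulr_ge0 ?powR_ge0.
have [xlarge|xsmall] := ltP (4 ^+ n * tau) x; last first.
  rewrite /layer_sum big_ord_recr /= ltNge xsmall mulr0 addr0.
  exact: IH.
have geometric m : \sum_(i < m.+1) q ^+ i <= 2 * q ^+ m.
  elim: m => [|m IHm]; first by rewrite big_ord_recr big_ord0 /= expr0; lra.
  rewrite big_ord_recr /= (le_trans (lerD IHm (lexx _))) // exprS.
  have qm_ge0 := exprn_ge0 m (ltW q_gt0).
  by have := ler_wpM2r qm_ge0 q_ge4; lra.
apply: (@le_trans _ _ (tau `^ p * (2 * q ^+ n))).
  rewrite ler_wpM2l // (le_trans _ (geometric n)) //.
  apply: ler_sum => i _; rewrite ler_piMr ?exprn_ge0 ?(ltW q_gt0) //.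
  by case: (_ < _).
rewrite mulrCA [_ * q ^+ n]mulrC -powR_scale ?(ltW tau0) // ler_pM2l //.
by rewrite ge0_ler_powR ?nnegrE ?mulr_ge0 ?exprn_ge0 // ltW.
Qed.

Context {d : measure_display} {T : measurableType d} (P : probability T R).

Let tail (Y : T -> R) (t : R) : R := fine (P [set w | t < Y w]).

Let tailE (Y : T -> R) (t : R) : measurable_fun [set: T] Y ->
  P [set w | t < Y w] = (tail Y t)%:E.
Proof.
by move=> mY; rewrite fineK // fin_num_measure //; exact: measurable_ltr_set.
Qed.

Let tail_ge0 (Y : T -> R) (t : R) : 0 <= tail Y t. Proof. by rewrite fine_ge0. Qed.

Lemma measurable_layer_sum (Y : T -> R) (tau : R) n : measurable_fun [set: T] Y ->
  measurable_fun [set: T] (fun w => layer_sum tau n (Y w)).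
Proof.
move=> mY; apply: measurable_sum => i; apply: measurable_funM => //.
apply: (measurableT_comp (f := fun b : bool => b%:R : R)) => //.
exact: measurable_fun_ltr.
Qed.

Let integral_layer_sum (Y : T -> R) (tau : R) n : measurable_fun [set: T] Y ->
  (\int[P]_w (layer_sum tau n (Y w))%:E =
   (\sum_(i < n) q ^+ i * tail Y (4 ^+ i * tau))%:E)%E.
Proof.
move=> mY; have qi_ge0 i : 0 <= q ^+ i by rewrite exprn_ge0 // ltW.
elim: n => [|n IH].
  under eq_integral do rewrite /layer_sum big_ord0.
  by rewrite big_ord0 integral0.
have m_set := measurable_ltr_set (measurable_cst (4 ^+ n * tau)) mY.
have -> : (\int[P]_w (layer_sum tau n.+1 (Y w))%:E =
    \int[P]_w ((layer_sum tau n (Y w))%:E +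
      (q ^+ n)%:E * (\1_[set w | (4 ^+ n * tau < Y w)%R] w)%:E))%E.
  apply: eq_integral => w _; rewrite -EFinM -EFinD; congr EFin.
  rewrite /layer_sum big_ord_recr /= indicE; congr (_ + _ * _%:R).
  by congr nat_of_bool; apply/idP/idP; rewrite in_setE.
rewrite ge0_integralD //; first last.
- by apply/measurable_EFinP; apply: measurable_funM.
- by move=> w _; rewrite -EFinM lee_fin mulr_ge0.
- by apply/measurable_EFinP; exact: measurable_layer_sum.
- by move=> w _; rewrite lee_fin layer_sum_ge0.
rewrite IH ge0_integralZl_EFin //; last by apply/measurable_EFinP.
have -> : (\int[P]_w (\1_[set w | (4 ^+ n * tau < Y w)%R] w)%:E)%E =
    (tail Y (4 ^+ n * tau))%:E by rewrite integral_indic // setIT; exact: tailE.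
by rewrite big_ord_recr /= -EFinM -EFinD.
Qed.

(** Going from t to 4 t multiplies the weight of a layer by 4^p. Summing the tail
    inequality over the levels thus bounds the layer sum of M by eps 4^p times
    itself plus that of S; as eps 4^p <= 1/2 the first term is absorbed. The
    truncation of M at the top level and the error in tau come from the levels
    left out. *)
Lemma good_lambda_moment (M S : T -> R) (eps : R) :
    measurable_fun [set: T] M -> measurable_fun [set: T] S ->
    (forall w, 0 <= M w) -> (forall w, 0 <= S w) ->
    eps * 4 `^ p <= 2^-1 ->
    (forall t : R, (0 < t)%R -> P [set w | (4 * t < M w)%R] <=
      eps%:E * P [set w | (t < M w)%R] + P [set w | (t < S w)%R])%E ->
  forall (tau : R) n, 0 < tau ->
  (\int[P]_w (Num.min (M w) (4 ^+ n * tau) `^ p)%:E <=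
   (tau `^ p * (1 + 2 * 4 `^ p))%:E +
   (4 * (4 `^ p) ^+ 2)%:E * \int[P]_w (S w `^ p)%:E)%E.
Proof.
move=> mM mS M0 S0; rewrite -/q => eps_q good tau n tau0.
have qi_ge0 i : 0 <= q ^+ i by rewrite exprn_ge0 // ltW.
have tp_ge0 : 0 <= tau `^ p by exact: powR_ge0.
pose A k := \sum_(i < k) q ^+ i * tail M (4 ^+ i * tau).
pose B k := \sum_(i < k) q ^+ i * tail S (4 ^+ i * tau).
have goodR t : 0 < t -> tail M (4 * t) <= eps * tail M t + tail S t.
  move=> /good; rewrite (tailE _ mM) (tailE _ mM) (tailE _ mS).
  by rewrite -EFinM -EFinD lee_fin.
have A_le : A n <= 2 + 2 * q * B n.
  have A_mono : A n <= A n.+1.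
    by rewrite /A big_ord_recr /= lerDl mulr_ge0.
  have A_rec : A n.+1 <= 1 + q * (eps * A n + B n).
    rewrite /A big_ord_recl /= expr0 !mul1r; apply: lerD.
      rewrite -lee_fin -(tailE _ mM) probability_le1 //; exact: measurable_ltr_set.
    rewrite mulrDr /A /B !mulr_sumr -big_split /=; apply: ler_sum => i _.
    rewrite /bump /= add1n !exprS -!mulrA.
    have := goodR (4 ^+ i * tau) ltac:(by rewrite mulr_gt0 ?exprn_gt0).
    move=> /(ler_wpM2l (qi_ge0 i)) /(ler_wpM2l (ltW q_gt0)); lra.
  have A_ge0 : 0 <= A n by apply: sumr_ge0 => i _; rewrite mulr_ge0.
  have := ler_wpM2r A_ge0 eps_q; lra.
have M_le : (\int[P]_w (Num.min (M w) (4 ^+ n * tau) `^ p)%:E <=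
    (tau `^ p + q * tau `^ p * A n)%:E)%E.
  apply: (@le_trans _ _ (\int[P]_w ((tau `^ p)%:E +
      (q * tau `^ p)%:E * (layer_sum tau n (M w))%:E))%E).
    apply: ge0_le_integral => //.
    - by move=> w _; rewrite lee_fin powR_ge0.
    - apply/measurable_EFinP; apply: measurableT_comp (measurable_powR p) _.
      exact: measurable_minr.
    - apply/measurable_EFinP; apply: measurable_funD => //.
      by apply: measurable_funM => //; exact: measurable_layer_sum.
    - by move=> w _; rewrite -EFinM -EFinD lee_fin powR_le_layer_sum.
  rewrite ge0_integralD //; first last.
  - apply/measurable_EFinP; apply: measurable_funM => //.
    exact: measurable_layer_sum.
  - move=> w _; rewrite -EFinM lee_fin mulr_ge0 ?layer_sum_ge0 //.
    by rewrite mulr_ge0 // ltW.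
  have -> : (\int[P]__ (tau `^ p)%:E = (tau `^ p)%:E)%E.
    by rewrite -[RHS]mule1 -(probability_setT P); exact: integral_cst.
  rewrite ge0_integralZl_EFin //; first last.
  - by rewrite mulr_ge0 // ltW.
  - by apply/measurable_EFinP; exact: measurable_layer_sum.
  - by move=> w _; rewrite lee_fin layer_sum_ge0.
  by rewrite integral_layer_sum // -EFinM -EFinD.
have S_ge : ((tau `^ p * B n)%:E <= 2%:E * \int[P]_w (S w `^ p)%:E)%E.
  rewrite EFinM -integral_layer_sum // -ge0_integralZl_EFin //; first last.
  - by apply/measurable_EFinP; exact: measurable_layer_sum.
  - by move=> w _; rewrite lee_fin layer_sum_ge0.
  rewrite -ge0_integralZl_EFin //; first last.
  - by apply/measurable_EFinP; apply: measurableT_comp (measurable_powR p) _.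
  - by move=> w _; rewrite lee_fin powR_ge0.
  apply: ge0_le_integral => //.
  - by move=> w _; rewrite -EFinM lee_fin mulr_ge0 ?layer_sum_ge0.
  - apply/measurable_EFinP; apply: measurable_funM => //.
    exact: measurable_layer_sum.
  - apply/measurable_EFinP; apply: measurable_funM => //.
    exact: measurableT_comp (measurable_powR p) _.
  - by move=> w _; rewrite -!EFinM lee_fin layer_sum_le_powR.
apply: le_trans M_le _.
apply: (@le_trans _ _ ((tau `^ p * (1 + 2 * q))%:E +
    (2 * q ^+ 2)%:E * (tau `^ p * B n)%:E)%E).
  rewrite -EFinM -EFinD lee_fin.
  have := ler_wpM2l (mulr_ge0 (ltW q_gt0) tp_ge0) A_le.
  by rewrite [q ^+ 2]expr2; lra.
apply: leeD => //.
have -> : 4 * q ^+ 2 = 2 * q ^+ 2 * 2 by ring.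
rewrite [in leRHS]EFinM -muleA lee_wpmul2l // lee_fin mulr_ge0 //.
Qed.

End GoodLambdaMoments.

(** * Passage to the limit and the moment inequality *)

Section Limit.
Context {R : realType} {X : completeNormedModType R}.
Context {d : measure_display} {T : measurableType d} (P : probability T R).
Context (f : nat -> T -> X).
Hypothesis mf : forall n, measurable_fun [set: T] (f n : T -> borel X).

Lemma norm_le_maximal_fun n w : (`|f n w|%:E <= maximal_fun f w)%E.
Proof. by apply: ereal_sup_ubound; exists n. Qed.

Lemma running_max_le_maximal_fun n w :
  ((running_max f n w)%:E <= maximal_fun f w)%E.
Proof.
elim: n => [|n IH]; first exact: norm_le_maximal_fun.
by rewrite running_maxS EFin_max ge_max IH norm_le_maximal_fun.
Qed.

Lemma maximal_fun_ge0 w : (0 <= maximal_fun f w)%E.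
Proof. by apply: le_trans (norm_le_maximal_fun 0 w); rewrite lee_fin. Qed.

(** The truncated running maxima increase to the maximal function. *)
Lemma integral_maximal_fun_le (p tau : R) (C : \bar R) : 1 <= p -> 0 < tau ->
  (forall n,
    \int[P]_w (Num.min (running_max f n w) (4 ^+ n * tau) `^ p)%:E <= C)%E ->
  (\int[P]_w (`|maximal_fun f w| `^ p) <= C)%E.
Proof.
move=> p1 tau0 bound; have p0 : 0 < p by exact: lt_le_trans p1.
pose g n w := (Num.min (running_max f n w) (4 ^+ n * tau) `^ p)%:E.
have min_ge0 n w : 0 <= Num.min (running_max f n w) (4 ^+ n * tau).
  by rewrite le_min running_max_ge0 mulr_ge0 ?exprn_ge0 // ltW.
have g_mono w : {homo g ^~ w : m n / (m <= n)%N >-> (m <= n)%E}.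
  move=> m n mn; rewrite lee_fin ge0_ler_powR ?nnegrE ?(ltW p0) //.
  rewrite le_min !ge_min (running_max_homo f w mn) /=; apply/orP; right.
  by rewrite ler_pM2r // ler_weXn2l //; lra.
have g_cvg w := ereal_nondecreasing_is_cvgn (g_mono w).
have g_le_lim n w : (g n w <= limn (g ^~ w))%E.
  have -> : limn (g ^~ w) = ereal_sup (range (g ^~ w)).
    by apply/cvg_lim => //; exact: ereal_nondecreasing_cvgn (g_mono w).
  by apply: ereal_sup_ubound; exists n.
have mg n : measurable_fun [set: T] (g n).
  apply/measurable_EFinP; apply: measurableT_comp (measurable_powR p) _.
  by apply: measurable_minr => //; apply: measurable_running_max.
have -> : (\int[P]_w (`|maximal_fun f w| `^ p) = \int[P]_w limn (g ^~ w))%E.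
  apply: eq_integral => w _; rewrite gee0_abs ?maximal_fun_ge0 //.
  apply/eqP; rewrite eq_le; apply/andP; split; last first.
    apply: lime_le => //; apply: nearW => n; rewrite /g -poweR_EFin.
    apply: gt0_ler_poweR;
      rewrite ?in_itv /= ?leey ?andbT ?lee_fin ?maximal_fun_ge0 //.
      exact: ltW.
    rewrite (le_trans _ (running_max_le_maximal_fun n w)) //.
    by rewrite lee_fin ge_min lexx.
  have lim_ge0 : (0 <= limn (g ^~ w))%E.
    by apply: le_trans (g_le_lim 0%N w); rewrite lee_fin powR_ge0.
  rewrite -[leRHS]poweRe1 // -[X in (_ <= _ `^ X)%E](@mulVf _ p) ?gt_eqF //.
  rewrite poweRrM.
  apply: gt0_ler_poweR;
    rewrite ?in_itv /= ?leey ?andbT ?maximal_fun_ge0 ?poweR_ge0 //.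
    exact: ltW.
  apply: ub_ereal_sup => _ [j _ <-].
  have [k fk] : exists k : nat, `|f j w| <= 4 ^+ k * tau.
    exists (Num.bound (`|f j w| / tau)); rewrite -ler_pdivrMr //.
    apply: le_trans (ltW (archi_boundP _)) _; first by rewrite divr_ge0 // ltW.
    rewrite -natrX ler_nat ltnW // ltn_expl //.
  pose n := maxn j k.
  have fjp : (`|f j w|%:E `^ p <= limn (g ^~ w))%E.
    apply: le_trans (g_le_lim n w); rewrite /g poweR_EFin lee_fin.
    rewrite ge0_ler_powR ?nnegrE ?(ltW p0) // le_min.
    rewrite (le_trans (norm_le_running_max f j w)); last first.
      by apply: running_max_homo; rewrite leq_maxl.
    rewrite (le_trans fk) // ler_pM2r // ler_weXn2l ?leq_maxr //; lra.
  rewrite -[leLHS]poweRe1 ?lee_fin //.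
  rewrite -[X in (_ `^ X <= _)%E](@mulfV _ p) ?gt_eqF //.
  rewrite poweRrM; apply: gt0_ler_poweR => //;
    rewrite ?in_itv /= ?leey ?andbT ?poweR_ge0 //.
  by rewrite invr_ge0 ltW.
rewrite (monotone_convergence P measurableT mg) //; last first.
  by move=> n w _; rewrite lee_fin powR_ge0.
apply: lime_le; last exact: nearW.
apply: ereal_nondecreasing_is_cvgn => m n mn; apply: ge0_le_integral => //.
- by move=> w _; rewrite lee_fin powR_ge0.
- by move=> w _; exact: g_mono.
Qed.

Lemma sqrt_square_sum_le n w :
  ((Num.sqrt (square_sum f n w))%:E <= square_fun f w)%E.
Proof.
rewrite -[leLHS]/(sqrte (square_sum f n w)%:E) lee_sqrt; last first.
  by apply: nneseries_ge0 => j _ _; rewrite lee_fin sqr_ge0.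
rewrite /square_sum -sumEFin; apply: nneseries_lim_ge => j _ _.
by rewrite lee_fin sqr_ge0.
Qed.

Lemma measurable_square_fun_powR (p : R) : separable X ->
  measurable_fun [set: T] (fun w => (`|square_fun f w| `^ p)%E).
Proof.
move=> X_separable.
pose u w : \bar R := (\sum_(1 <= j <oo) (`|increment f j w| ^+ 2)%:E)%E.
have u_ge0 w : (0 <= u w)%E.
  by apply: nneseries_ge0 => j _ _; rewrite lee_fin sqr_ge0.
have -> : (fun w => (`|square_fun f w| `^ p)%E) =
    (fun w => (u w `^ (2^-1 * p))%E).
  apply/funext => w; rewrite poweRrM poweR12_sqrt //.
  by rewrite gee0_abs // sqrte_ge0.
apply: (measurableT_comp (measurable_poweR _)).
apply: (emeasurable_fun_cvg
  (fun n w => \sum_(1 <= j < n) (`|increment f j w| ^+ 2)%:E)%E).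
  move=> n; under eq_fun do rewrite sumEFin.
  apply/measurable_EFinP; apply: measurable_sum => j.
  apply: measurable_funX; apply: measurable_norm.
  by apply: measurable_borelD => //; exact: measurable_borelN.
by move=> w _; apply: is_cvg_nneseries => j _ _; rewrite lee_fin sqr_ge0.
Qed.

End Limit.

Lemma poweR_cst_Lnorm_le (R : realType) (d : measure_display)
    (T : measurableType d) (P : probability T R) (p C : R) (f g : T -> \bar R) :
  0 < p -> 0 <= C ->
  (\int[P]_w (`|f w| `^ p) <= (C `^ p)%:E * \int[P]_w (`|g w| `^ p))%E ->
  ('N[P]_p%:E[f] <= C%:E * 'N[P]_p%:E[g])%E.
Proof.
move=> p0 C0 fg; rewrite unlock /=.
have pV0 : 0 <= p^-1 by rewrite invr_ge0 ltW.
have int_ge0 (h : T -> \bar R) : (0 <= \int[P]_w (`|h w| `^ p))%E.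
  by apply: integral_ge0 => w _; exact: poweR_ge0.
have Cp : (C%:E = (C `^ p)%:E `^ p^-1)%E.
  by rewrite poweR_EFin -powRrM mulfV ?gt_eqF // powRr1.
rewrite Cp -poweRM ?lee_fin ?powR_ge0 //.
apply: gt0_ler_poweR => //; rewrite in_itv /= leey andbT ?int_ge0 //.
by rewrite mule_ge0 // lee_fin powR_ge0.
Qed.

(** The decay exp (- 11 p) of the tail inequality beats the growth 4^p of the
    layers uniformly in p, since 4 <= exp 3. *)
Lemma good_lambda_factor_le (R : realType) (p : R) : 1 <= p ->
  expR (- (11 * p)) * 4 `^ p <= 2^-1.
Proof.
move=> p1; have four_le : 4 <= expR 3 :> R.
  by have := @expR_ge1Dx R 3; lra.
have powR4_le : 4 `^ p <= expR (3 * p).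
  by rewrite expRM ge0_ler_powR ?nnegrE ?expR_ge0 //; lra.
apply: (@le_trans _ _ (expR (- (11 * p)) * expR (3 * p))).
  by rewrite ler_wpM2l ?expR_ge0.
rewrite -expRD (_ : - (11 * p) + 3 * p = - (8 * p)); last by ring.
rewrite expRN lef_pV2 ?posrE ?expR_gt0 //.
by have := expR_ge1Dx (8 * p); lra.
Qed.

(** The factor 15 turns the threshold for the square sum into a threshold for the
    square function, and 4 ^ 3 comes from bounding the factor 4 * (4 ^ p) ^ 2 of
    the moment inequality by (4 ^ 3) ^ p: the product is 960. *)
Definition moment_constant (R : realType) : R := 960.

Section MomentInequality.
Context {R : realType} {X : completeNormedModType R} (D : R).
Hypotheses (X_separable : separable X) (X_smooth : smooth2 X D) (D_ge1 : 1 <= D).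
Context {d : measure_display} {T : measurableType d} (P : probability T R).
Context (F : nat -> set (set T)) (f : nat -> T -> X).
Hypothesis F_filtration : filtration F.
Hypothesis f_adapted : forall n, measurable_fun [set: g_sigma_algebraType (F n)]
  (f n : g_sigma_algebraType (F n) -> borel X).
Hypothesis f0 : forall w, f 0%N w = 0.
Hypothesis f_symmetric : forall j : nat, (1 <= j)%N ->
  cond_symmetric P (F j.-1) (increment f j).

Let mf n : measurable_fun [set: T] (f n : T -> borel X).
Proof. exact: adapted_measurable F_filtration f_adapted n. Qed.

(** The factor sqrt p D appears here: the weight can be followed only while the
    square sum is below t^2 / (225 p D^2). *)
Lemma good_lambda_sqrt (p t : R) n : 1 <= p -> 0 < t ->
  (P [set w | (4 * t < running_max f n w)%R] <=
   (expR (- (11 * p)))%:E * P [set w | (t < running_max f n w)%R] +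
   P [set w | (t < 15 * Num.sqrt p * D * Num.sqrt (square_sum f n w))%R])%E.
Proof.
move=> p1 t0.
have mM : measurable_fun [set: T] (running_max f n).
  exact: measurable_running_max.
have ms : measurable_fun [set: T] (square_sum f n).
  exact: measurable_square_sum.
pose b := t ^+ 2 / (225 * p * D ^+ 2).
have m1 := measurable_ltr_set (measurable_cst (4 * t)) mM.
have m2 := measurable_ler_set ms (measurable_cst b).
have m3 := measurable_ltr_set (measurable_cst b) ms.
have p0 : 0 < p by exact: lt_le_trans p1.
have D0 : 0 < D by exact: lt_le_trans D_ge1.
have rescale w : (t < 15 * Num.sqrt p * D * Num.sqrt (square_sum f n w)) =
    (b < square_sum f n w).
  rewrite /b ltr_pdivrMr; last first.
    apply: mulr_gt0; last exact: exprn_gt0.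
    by apply: mulr_gt0; [rewrite ltr0n | exact: p0].
  rewrite -(@ltr_pXn2r _ 2) ?nnegrE ?(ltW t0) //; last first.
    apply: mulr_ge0; last exact: sqrtr_ge0.
    by apply: mulr_ge0; [apply: mulr_ge0 => //; exact: sqrtr_ge0 | exact: ltW].
  rewrite !exprMn !sqr_sqrtr ?square_sum_ge0 ?(ltW p0) //.
  by congr (_ < _); ring.
have -> : [set w | t < 15 * Num.sqrt p * D * Num.sqrt (square_sum f n w)] =
    [set w | b < square_sum f n w].
  by apply/seteqP; split => w /=; rewrite rescale.
pose C := [set w | 4 * t < running_max f n w /\ square_sum f n w <= b].
have mC : measurable C by exact: measurableI.
have C_le : (P C <= (expR (- (11 * p)))%:E *
    P [set w | (t < running_max f n w)%R])%E.
  have := good_lambda_square X_separable X_smooth D_ge1 F_filtration f_adapted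
    f0 f_symmetric p1 t0 n.
  move=> /(@lee_wpmul2l _ (expR (- (15 * p)))%:E (expR_ge0 _)).
  rewrite !muleA -!EFinM -!expRD addNr expR0 mul1e.
  by rewrite (_ : - (15 * p) + 4 * p = - (11 * p)) //; ring.
apply: (@le_trans _ _ (P (C `|` [set w | b < square_sum f n w]))).
  apply: le_measure; rewrite ?inE //; first exact: measurableU.
  move=> w /= tM; have [sb|bs] := leP (square_sum f n w) b; last by right.
  by left.
by apply: le_trans (measureU2 _ mC m3) _; rewrite leeD2r.
Qed.

Lemma integral_running_max_le (p tau : R) n : 1 <= p -> 0 < tau ->
  (\int[P]_w (Num.min (running_max f n w) (4 ^+ n * tau) `^ p)%:E <=
   (tau `^ p * (1 + 2 * 4 `^ p))%:E +
   ((moment_constant R * Num.sqrt p * D) `^ p)%:E *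
     \int[P]_w (`|square_fun f w| `^ p))%E.
Proof.
move=> p1 tau0; have p0 : 0 < p by exact: lt_le_trans p1.
pose c := 15 * Num.sqrt p * D.
have c0 : 0 <= c.
  rewrite /c; apply: mulr_ge0; last exact: le_trans D_ge1.
  by apply: mulr_ge0 => //; exact: sqrtr_ge0.
pose S w := c * Num.sqrt (square_sum f n w).
have S0 w : 0 <= S w by rewrite mulr_ge0 // sqrtr_ge0.
have mS : measurable_fun [set: T] S.
  apply: measurable_funM => //.
  under eq_fun do rewrite -powR12_sqrt ?square_sum_ge0 //.
  apply: measurableT_comp (measurable_powR _) _.
  exact: measurable_square_sum.
have mM : measurable_fun [set: T] (running_max f n).
  exact: measurable_running_max.
apply: le_trans (good_lambda_moment p1 mM mS _ S0
  (good_lambda_factor_le p1) _ n tau0) _.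
- by move=> w; exact: running_max_ge0.
- by move=> t t0; exact: good_lambda_sqrt.
apply: leeD; first exact: lexx.
have S_le : (\int[P]_w (S w `^ p)%:E <=
    (c `^ p)%:E * \int[P]_w (`|square_fun f w| `^ p))%E.
  have msq := measurable_square_fun_powR mf p X_separable.
  rewrite -ge0_integralZl_EFin ?powR_ge0 //; last by move=> w _; exact: poweR_ge0.
  apply: ge0_le_integral => //.
  - by move=> w _; rewrite lee_fin powR_ge0.
  - by apply/measurable_EFinP; exact: measurableT_comp (measurable_powR p) _.
  - by apply: emeasurable_funM => //; exact: measurable_cst.
  move=> w _; rewrite /S powRM ?sqrtr_ge0 // EFinM.
  rewrite lee_wpmul2l ?lee_fin ?powR_ge0 //.
  rewrite -poweR_EFin.
  have sq_ge0 : (0 <= square_fun f w)%E by exact: sqrte_ge0.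
  rewrite gee0_abs //; apply: gt0_ler_poweR; first exact: ltW.
  - by rewrite in_itv /= leey andbT lee_fin sqrtr_ge0.
  - by rewrite in_itv /= leey andbT.
  - exact: sqrt_square_sum_le.
apply: le_trans (lee_wpmul2l _ S_le) _.
  by rewrite lee_fin mulr_ge0 ?sqr_ge0.
rewrite muleA -EFinM; apply: lee_wpmul2r.
  by apply: integral_ge0 => w _; exact: poweR_ge0.
have -> : moment_constant R * Num.sqrt p * D = 4 * (4 * (4 * c)).
  by rewrite /moment_constant /c; ring.
have powR4M y : 0 <= y -> (4 * y) `^ p = 4 `^ p * y `^ p.
  by move=> y0; rewrite powRM.
have c4 : 0 <= 4 * c by exact: mulr_ge0.
have c16 : 0 <= 4 * (4 * c) by exact: mulr_ge0.
rewrite lee_fin (powR4M _ c16) (powR4M _ c4) (powR4M _ c0).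
have four_le : 4 <= 4 `^ p :> R by rewrite -[leLHS]powRr1 // ler_powR //; lra.
have -> : 4 * 4 `^ p ^+ 2 * c `^ p = 4 * (4 `^ p * (4 `^ p * c `^ p)) by ring.
apply: ler_wpM2r four_le.
by apply: mulr_ge0; [|apply: mulr_ge0]; exact: powR_ge0.
Qed.

Lemma Lnorm_maximal_fun_le (p : R) : 1 <= p ->
  ('N[P]_p%:E[maximal_fun f] <=
   (moment_constant R * Num.sqrt p * D)%:E * 'N[P]_p%:E[square_fun f])%E.
Proof.
move=> p1; have p0 : 0 < p by exact: lt_le_trans p1.
apply: (poweR_cst_Lnorm_le p0).
  apply: mulr_ge0; last exact: le_trans D_ge1.
  by apply: mulr_ge0; [rewrite /moment_constant ler0n | exact: sqrtr_ge0].
apply/lee_addgt0Pr => e e0.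
pose K : R := 1 + 2 * 4 `^ p.
have K0 : 0 < K by rewrite /K; have := @powR_ge0 R 4 p; lra.
pose tau := (e / K) `^ p^-1.
have tau_p : tau `^ p * K = e.
  rewrite /tau -powRrM mulVf ?gt_eqF // powRr1 ?divr_ge0 ?ltW //.
  by rewrite divfK ?gt_eqF.
have tau0 : 0 < tau by rewrite powR_gt0 // divr_gt0.
rewrite -tau_p addeC.
apply: (integral_maximal_fun_le mf p1 tau0) => n.
exact: integral_running_max_le.
Qed.

End MomentInequality.

Theorem theorem4p3 (R : realType) :
  exists2 A : R, 0 < A &
    forall (D : R) (X : completeNormedModType R),
      0 < D -> separable X -> smooth2 X D ->
    forall (d : measure_display) (T : measurableType d) (P : probability T R)
      (F : nat -> set (set T)) (f : nat -> T -> X),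
      martingale P F f -> (forall w, f 0%N w = 0) ->
      (forall j : nat, (1 <= j)%N -> cond_symmetric P (F j.-1) (increment f j)) ->
    forall p : R, 1 <= p ->
      ('N[P]_p%:E [maximal_fun f]
        <= (A * Num.sqrt p * D)%:E * 'N[P]_p%:E [square_fun f])%E.
Proof.
exists (moment_constant R); first by rewrite /moment_constant ltr0n.
move=> D X D0 X_separable X_smooth d T P F f [F_filt f_adapted _ _] f0
  f_symmetric p p1.
(* D < 1 is possible only in the zero space, where the maximal function is 0. *)
have [D_ge1|D_lt1] := leP 1 D.
  exact (Lnorm_maximal_fun_le X_separable X_smooth D_ge1 F_filt f_adapted f0
    f_symmetric p1).
have X0 (x : X) : x = 0.
  by apply: contraTeq D_lt1 => x0; rewrite -leNgt; exact: smooth2_ge1 x0.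
have -> : maximal_fun f = cst 0%E.
  apply/funext => w; apply/eqP; rewrite eq_le maximal_fun_ge0 andbT.
  by apply: ub_ereal_sup => _ [j _ <-]; rewrite (X0 (f j w)) normr0.
have p0 : 0 < p by exact: lt_le_trans p1.
rewrite Lnorm0; last by rewrite eqe gt_eqF.
apply: mule_ge0; last exact: Lnorm_ge0.
rewrite lee_fin; apply: mulr_ge0; last exact: ltW.
by apply: mulr_ge0; [rewrite /moment_constant ler0n | exact: sqrtr_ge0].
Qed.
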